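(* Let $\mathfrak g$ be a finite-dimensional Lie algebra over a field $\mathbb F$ of characteristic zero. Then $\mathfrak g$ is nilpotent if and only if $\mathfrak g$ admits an invertible Leibniz-derivation, i.e. there exist an integer $k\ge 1$ and an invertible linear map $P:\mathfrak g\to\mathfrak g$ that is a Leibniz-derivation of order $k$.
   Context: For a Lie algebra $\mathfrak g$, an integer $k\ge1$ and $x_1,\dots,x_{k+1}\in\mathfrak g$, write $[x_1,\dots,x_{k+1}]$ for the right-nested bracket $[x_1,[x_2,[\dots,[x_k,x_{k+1}]\dots]]]$ (and $[x]=x$ for a single element). A Leibniz-derivation of order $k$ of $\mathfrak g$ is a linear map $P:\mathfrak g\to\mathfrak g$ such that $P([x_1,\dots,x_{k+1}])=\sum_{i=1}^{k+1}[x_1,\dots,x_{i-1},P(x_i),x_{i+1},\dots,x_{k+1}]$ for all $x_1,\dots,x_{k+1}\in\mathfrak g$. The set of these is denoted $\mathcal{L}\mathrm{Der}_k(\mathfrak g)$, and $\mathcal{L}\mathrm{Der}(\mathfrak g)=\bigcup_{k\ge1}\mathcal{L}\mathrm{Der}_k(\mathfrak g)$; its elements are called Leibniz-derivations. Leibniz-derivations of order $1$ are exactly the ordinary derivations. *)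

(* Defs.v *)
From HB Require Import structures.
From mathcomp Require Import all_boot all_order all_algebra.
Set Implicit Arguments. Unset Strict Implicit. Unset Printing Implicit Defensive.
Import GRing.Theory.
Local Open Scope ring_scope.

Section Lie.
Variables (F : fieldType) (V : vectType F) (br : V -> V -> V).

Definition is_lie_bracket : Prop :=
  [/\ (forall (a : F) (x y z : V), br (a *: x + y) z = a *: br x z + br y z),
      (forall (a : F) (x y z : V), br x (a *: y + z) = a *: br x y + br x z),
      (forall x : V, br x x = 0) &
      (forall x y z : V, br x (br y z) + br y (br z x) + br z (br x y) = 0)].

Fixpoint rnest (s : seq V) : V :=
  match s with
  | [::] => 0
  | [:: x] => x
  | x :: s' => br x (rnest s')
  end.

Definition leibniz_der (k : nat) (P : 'End(V)) : Prop :=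
  forall s : seq V, size s = k.+1 ->
    P (rnest s) = \sum_(i < k.+1) rnest (set_nth 0 s i (P (nth 0 s i))).

(* [A, B] : subspace spanned by all brackets [a, b], a in A, b in B
   (spanned by brackets of basis vectors, by bilinearity) *)
Definition bracket_space (A B : {vspace V}) : {vspace V} :=
  (<< [seq br x y | x <- vbasis A, y <- vbasis B] >>)%VS.

Fixpoint lcs (n : nat) : {vspace V} :=
  match n with
  | 0 => fullv
  | n'.+1 => bracket_space fullv (lcs n')
  end.

Definition lie_nilpotent : Prop := exists n : nat, lcs n = 0%VS.

End Lie.

(* Main.v *)
Require Import Defs.
From HB Require Import structures.
From mathcomp Require Import all_boot all_order all_algebra all_field.
From Stdlib Require Import Classical.
Set Implicit Arguments. Unset Strict Implicit. Unset Printing Implicit Defensive.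
Import GRing.Theory VectorInternalTheory.
Local Open Scope ring_scope.

(* If [g] is nilpotent of class [c], brackets of more than [c] elements vanish and
   the identity is a Leibniz-derivation of order [c].

   Conversely, extend scalars to a field splitting the characteristic polynomial of
   [P]. A bracket of [k + 1] generalized eigenvectors of [P] has as weight the sum
   of their weights. The weights are nonzero and the characteristic is zero, so
   they can be split into two classes such that no nonempty sum of weights of one
   class vanishes. For each class, long products of [ad x], with [x] of weight in
   that class, strictly change weights at every [k]-th step and hence vanish; so [g]
   is the sum of two subalgebras [n1], [n2] acting nilpotently on [g]. Finally, let
   [U] contain [n1] and be maximal among the subalgebras acting nilpotently on [g].
   If [U] is proper its normalizer is larger, hence contains some [b] in [n2]
   outside [U], and [U + <[b]>] still acts nilpotently. So [U = g]. *)

(** * Bracket identities and sets acting nilpotently *)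

Section LieNilpotency.
Variables (F : fieldType) (V : vectType F) (br : V -> V -> V).
Hypothesis hLie : is_lie_bracket br.
Implicit Types (S : V -> Prop) (x y z u v w : V) (U : {vspace V}).

Lemma brDl x y z : br (x + y) z = br x z + br y z.
Proof. by case: hLie => + _ _ _ => /(_ 1 x y z); rewrite !scale1r. Qed.

Lemma brDr x y z : br x (y + z) = br x y + br x z.
Proof. by case: hLie => _ + _ _ => /(_ 1 x y z); rewrite !scale1r. Qed.

Lemma br0l x : br 0 x = 0.
Proof. by apply: (addrI (br 0 x)); rewrite -brDl !addr0. Qed.

Lemma br0r x : br x 0 = 0.
Proof. by apply: (addrI (br x 0)); rewrite -brDr !addr0. Qed.

Lemma brZl a x y : br (a *: x) y = a *: br x y.
Proof. by case: hLie => + _ _ _ => /(_ a x 0 y); rewrite br0l !addr0. Qed.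

Lemma brZr a x y : br x (a *: y) = a *: br x y.
Proof. by case: hLie => _ + _ _ => /(_ a x y 0); rewrite br0r !addr0. Qed.

Lemma brNr x y : br x (- y) = - br x y.
Proof. by rewrite -scaleN1r brZr scaleN1r. Qed.

Lemma br_xx x : br x x = 0.
Proof. by case: hLie. Qed.

Lemma br_anti x y : br x y = - br y x.
Proof.
apply/eqP; rewrite -addr_eq0.
by have := br_xx (x + y); rewrite brDl !brDr !br_xx add0r addr0 => ->.
Qed.

Lemma br_jacobi x y z : br x (br y z) = br (br x y) z + br y (br x z).
Proof.
case: hLie => _ _ _ /(_ x y z).
rewrite (br_anti z x) brNr (br_anti z) => /eqP.
by rewrite -addrA -opprD subr_eq0 addrC => /eqP.
Qed.

(** For fixed [S] the vectors with [kills S j] form an ascending chain of subspaces;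
    [acts_nilpotently] says that it reaches [V]. A mere predicate [S] is allowed because sets of
    weight vectors are not subspaces. *)
Fixpoint kills S j v : Prop :=
  if j is j'.+1 then forall u, S u -> kills S j' (br u v) else v = 0.

Definition acts_nilpotently S : Prop := exists n, forall v, kills S n v.

Lemma kills0 S j : kills S j 0.
Proof. by elim: j => //= j IH u _; rewrite br0r. Qed.

Lemma killsD S j v w : kills S j v -> kills S j w -> kills S j (v + w).
Proof.
elim: j v w => /= [v w -> ->|j IH v w kv kw u Su]; first by rewrite addr0.
by rewrite brDr; apply: IH; [apply: kv | apply: kw].
Qed.

Lemma killsZ S j a v : kills S j v -> kills S j (a *: v).
Proof.
elim: j v => /= [v ->|j IH v kv u Su]; first by rewrite scaler0.
by rewrite brZr; apply/IH/kv.
Qed.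

Lemma killsS S j v : kills S j v -> kills S j.+1 v.
Proof.
elim: j v => [v -> u _|j IH v kv u Su]; first exact: br0r.
by apply: IH; apply: kv.
Qed.

Lemma sub_kills (S S' : V -> Prop) j v :
  (forall x, S' x -> S x) -> kills S j v -> kills S' j v.
Proof. by move=> sS; elim: j v => //= j IH v kv u /sS Su; apply/IH/kv. Qed.

Lemma kills_iter S j x v : S x -> kills S j v -> iter j (br x) v = 0.
Proof.
move=> Sx; elim: j v => //= j IH v kv.
by rewrite -iterS iterSr IH //; apply: kv.
Qed.

(* A subalgebra containing [S] and acting as nilpotently as [S] does. *)
Definition nil_envelope S x : Prop :=
  forall j v, kills S j.+1 v -> kills S j (br x v).

Lemma sub_nil_envelope S x : S x -> nil_envelope S x.
Proof. by move=> Sx j v; apply. Qed.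

Lemma nil_envelope0 S : nil_envelope S 0.
Proof. by move=> j v _; rewrite br0l; apply: kills0. Qed.

Lemma nil_envelopeD S x y :
  nil_envelope S x -> nil_envelope S y -> nil_envelope S (x + y).
Proof. by move=> nx ny j v kv; rewrite brDl; apply: killsD; [apply: nx | apply: ny]. Qed.

Lemma nil_envelopeZ S a x : nil_envelope S x -> nil_envelope S (a *: x).
Proof. by move=> nx j v kv; rewrite brZl; apply/killsZ/nx. Qed.

(** The action of [br x y] is the commutator of those of [x] and [y], and both composites go down
    the chain. *)
Lemma nil_envelope_br S x y :
  nil_envelope S x -> nil_envelope S y -> nil_envelope S (br x y).
Proof.
move=> nx ny j v kv.
have -> : br (br x y) v = br x (br y v) + (-1) *: br y (br x v).
  by rewrite br_jacobi scaleN1r addrK.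
apply: killsD; last apply: killsZ.
  by apply: nx; apply: killsS; apply: ny.
by apply: ny; apply: killsS; apply: nx.
Qed.

Lemma nil_envelope_nilp S :
  acts_nilpotently S -> acts_nilpotently (nil_envelope S).
Proof.
case=> n kn; exists n => v.
suff H j w : kills S j w -> kills (nil_envelope S) j w by apply: H.
by elim: j w => //= j IH w kw x nx; apply/IH/nx.
Qed.

(** * Enlarging nilpotently acting subalgebras *)

Lemma codim_add_line U y m : y \notin U -> (\dim {:V} - \dim U <= m.+1)%N ->
  (\dim {:V} - \dim (U + <[y]>)%VS <= m)%N.
Proof.
move=> yU; have dU : (\dim U < \dim (U + <[y]>))%N.
  rewrite ltn_neqAle dimvS ?addvSl // andbT; apply: contra yU => /eqP e.
  have /eqP-> : U == (U + <[y]>)%VS by rewrite eqEdim addvSl -e /=.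
  by rewrite memvE addvSr.
by rewrite !leq_subLR addnS => /leq_trans; apply; rewrite -addSn leq_add2r.
Qed.

(** Membership in [S] is settled classically: vectors of [S] are adjoined to a subspace until none
    is missing, which finite dimension forces. *)
Lemma vspace_of_pred S :
    S 0 -> (forall a x y, S x -> S y -> S (a *: x + y)) ->
  exists U, forall x, x \in U <-> S x.
Proof.
move=> S0 SD.
suff H m U : (\dim {:V} - \dim U <= m)%N -> (forall x, x \in U -> S x) ->
    exists U', forall x, x \in U' <-> S x.
  by apply: (H _ 0%VS (leqnn _)) => x; rewrite memv0 => /eqP->.
elim: m U => [|m IH] U hU sU.
  exists U => x; split; first exact: sU.
  have /eqP-> : U == fullv by rewrite eqEdim subvf -subn_eq0 -leqn0.
  by rewrite memvf.
case: (classic (forall x, S x -> x \in U)) => [h|/not_all_ex_not[x hx]].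
  by exists U => x; split; [apply: sU | apply: h].
case: (imply_to_and _ _ hx) => Sx /negP xU.
apply: (IH (U + <[x]>)%VS); first exact: codim_add_line.
move=> z /memv_addP[y yU [_ /vlineP[a ->] ->]]; rewrite addrC.
by apply: SD => //; apply: sU.
Qed.

(** If [U] were its own normalizer, induction on [j] would put every vector with [kills U j] into
    [U], hence all of [V]. *)
Lemma normalizer_grows U : acts_nilpotently (fun x => x \in U) -> U <> fullv ->
  exists2 v, v \notin U & forall u, u \in U -> br u v \in U.
Proof.
case=> n kn nUV; apply: NNPP => nex; apply: nUV.
apply/eqP; rewrite eqEsubv subvf; apply/subvP => v _ /=.
suff H j w : kills (fun x => x \in U) j w -> w \in U by apply: H (kn v).
elim: j w => /= [w ->|j IH w kw]; first exact: mem0v.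
apply/negP => /negP wU; apply: nex; exists w => // u uU.
by apply: IH; apply: kw.
Qed.

(** By Jacobi, moving [u] past [y] costs only a bracket with [br u y], which is again in [S]. *)
Lemma kills_stable S y j v : (forall u, S u -> S (br u y)) ->
  kills S j v -> kills S j (br y v).
Proof.
move=> nSy; elim: j v => /= [v ->|j IH v kv u Su]; first exact: br0r.
rewrite br_jacobi; apply: killsD; first by apply: kv; apply: nSy.
by apply: IH; apply: kv.
Qed.

Lemma acts_nilpotently_add_line U y m : acts_nilpotently (fun x => x \in U) ->
    (forall u, u \in U -> br u y \in U) -> (forall v, iter m (br y) v = 0) ->
  acts_nilpotently (fun x => x \in (U + <[y]>)%VS).
Proof.
set S := fun x => x \in U; set S' := fun x => x \in (U + <[y]>)%VS.
move=> [n kn] nUy ym.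
have stab : forall j v, kills S j v -> kills S j (br y v).
  by move=> j v; apply: kills_stable.
(* Modulo [kills S j], an element of [U + <[y]>] acts on [kills S j.+1] as a
   multiple of [y]; so [m] of them map the latter into the former. *)
have step j i l v w a : kills S j.+1 w -> kills S j (v - a *: iter l (br y) w) ->
    (l + i = m)%N -> (forall z, kills S j z -> kills S' (j * m) z) ->
    kills S' (i + j * m) v.
  move=> kw; elim: i l v a => [|i IH] l v a kv hl hj /=.
    (* After [m] factors the multiple of [iter m (br y) w] vanishes, so [v] itself satisfies
       [kills S j]. *)
    by apply: hj; move: kv; rewrite -[l]addn0 hl ym scaler0 subr0.
  move=> x /memv_addP[u uU [_ /vlineP[b ->] ->]].
  apply: (IH l.+1 _ (b * a)) => //; last by rewrite addSnnS.
  have -> : br (u + b *: y) v - (b * a) *: iter l.+1 (br y) w =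
     br u v + b *: br y (v - a *: iter l (br y) w).
    by rewrite brDl brZl brDr brNr brZr scalerDr scalerN scalerA addrA.
  apply: killsD; last by apply/killsZ/stab.
  have -> : v = (v - a *: iter l (br y) w) + a *: iter l (br y) w by rewrite subrK.
  rewrite brDr; apply: killsD; first by apply: killsS kv _ uU.
  rewrite brZr; apply: killsZ.
  have : kills S j.+1 (iter l (br y) w).
    by elim: (l) => // l' IHl; rewrite iterS; apply: stab.
  by apply.
have all j z : kills S j z -> kills S' (j * m) z.
  elim: j z => [z //|j IH z kz]; rewrite mulSn.
  by apply: (step j m 0%N z z 1) => //; rewrite scale1r subrr; apply: kills0.
by exists (n * m)%N => v; apply: all.
Qed.

Theorem nilpotent_sum (S1 S2 : V -> Prop) :
    acts_nilpotently S1 -> acts_nilpotently S2 ->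
    (forall v, exists a b, [/\ nil_envelope S1 a, nil_envelope S2 b & v = a + b]) ->
  acts_nilpotently (fun _ => True).
Proof.
move=> n1 n2 sum12.
have [U1 hU1] : exists U, forall x, x \in U <-> nil_envelope S1 x.
  apply: vspace_of_pred; first exact: nil_envelope0.
  by move=> a x y nx ny; apply: nil_envelopeD => //; apply: nil_envelopeZ.
(* Induction on the codimension of a subalgebra [U] containing the envelope of [S1]. *)
suff H m U : (\dim {:V} - \dim U <= m)%N ->
    (forall x, nil_envelope S1 x -> x \in U) ->
    (forall x y, x \in U -> y \in U -> br x y \in U) ->
    acts_nilpotently (fun x => x \in U) -> acts_nilpotently (fun _ => True).
  apply: (H _ U1 (leqnn _)) => [x|x y|].
  - by move/hU1.
  - by move=> /hU1 nx /hU1 ny; apply/hU1/nil_envelope_br.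
  - case: (nil_envelope_nilp n1) => n kn; exists n => v.
    by apply: sub_kills (kn v) => x /hU1.
elim: m U => [|m IH] U hU sU aU nU.
  case: nU => n kn; exists n => v; apply: sub_kills (kn v) => x _.
  have /eqP-> : U == fullv by rewrite eqEdim subvf -subn_eq0 -leqn0.
  exact: memvf.
case: (classic (U = fullv)) => [eU|neU].
  by case: nU => n kn; exists n => v; apply: sub_kills (kn v) => x _; rewrite eU memvf.
have [v vU nv] := normalizer_grows nU neU.
(* As [a] lies in [U], the summand [b] inherits from [v] that it normalizes [U] and lies outside
   it. *)
have [a [b [na nb ev]]] := sum12 v.
have aU1 := sU _ na.
have bU : b \notin U by apply: contra vU => bU; rewrite ev memvD.
have nUb u : u \in U -> br u b \in U.
  move=> uU; have -> : br u b = br u v - br u a by rewrite ev brDr addrC addKr.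
  by rewrite memvB ?nv ?aU.
case: (nil_envelope_nilp n2) => m2 km2.
have bnil w : iter m2 (br b) w = 0 by apply: (kills_iter nb); apply: km2.
apply: (IH (U + <[b]>)%VS).
- exact: codim_add_line.
- by move=> x nx; apply: subvP (addvSl _ _) _ (sU x nx).
- move=> x y /memv_addP[x1 x1U [_ /vlineP[c ->] ->]].
  move=> /memv_addP[y1 y1U [_ /vlineP[d ->] ->]].
  (* The bracket already lands in [U]: [br b b] vanishes and [b] normalizes [U]. *)
  apply: subvP (addvSl _ _) _ _.
  rewrite brDl !brDr !brZl !brZr br_xx !scaler0 addr0.
  have nbU : br b y1 \in U by rewrite br_anti memvN nUb.
  by apply: memvD; [apply: memvD; [apply: aU | apply/memvZ/nUb] | apply: memvZ].
- exact: acts_nilpotently_add_line bnil.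
Qed.

End LieNilpotency.

(** * Sums of weights that never vanish *)

Section Cones.
Variable F : fieldType.
Implicit Types (T : seq F) (s t l : F).

(** The additive semigroup generated by [T]. The empty sum is excluded, so [~ cone T 0] expresses
    that the cone is pointed. *)
Inductive cone T : F -> Prop :=
| cone_gen t : t \in T -> cone T t
| coneD s t : cone T s -> cone T t -> cone T (s + t).

Lemma coneMn T t n : (0 < n)%N -> cone T t -> cone T (t *+ n).
Proof.
case: n => // n _ ct; elim: n => [|n IH]; first by rewrite mulr1n.
by rewrite mulrS; apply: coneD.
Qed.

(** The disjunction records that the sum is nonempty: without a part from [T], the generator [l]
    occurs. *)
Lemma cone_consP T l s : cone (l :: T) s ->
  exists n t, s = l *+ n + t /\ ((0 < n)%N /\ t = 0 \/ cone T t).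
Proof.
elim=> {s} [s|s t _ [n [s' [-> hs]]] _ [m [t' [-> ht]]]].
  rewrite inE => /orP[/eqP->|sT].
    by exists 1%N, 0; rewrite mulr1n addr0; split; [|left].
  by exists 0%N, s; rewrite mulr0n add0r; split; [|right; apply: cone_gen].
exists (n + m)%N, (s' + t'); split; first by rewrite mulrnDr addrACA.
case: hs ht => [[n0 ->]|cs] [[m0 ->]|ct].
- by left; rewrite addr0 addn_gt0 n0.
- by right; rewrite add0r.
- by right; rewrite addr0.
- by right; apply: coneD.
Qed.

Hypothesis charF0 : [pchar F] =i pred0.

Lemma mulrn_neq0 l n : l != 0 -> (0 < n)%N -> l *+ n <> 0.
Proof.
move=> l0 n0 /eqP; rewrite -mulr_natr mulf_eq0 (negPf l0) /=.
by move/pcharf0P: charF0 => ->; rewrite eqn0Ngt n0.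
Qed.

(** If both signs failed, then [l *+ n + t = 0] and [- l *+ m + t' = 0] with [t], [t'] in the cone,
    and [t *+ m + t' *+ n] would be a vanishing sum over [T]. *)
Lemma cone_cons_sign T l : l != 0 -> ~ cone T 0 ->
  ~ cone (l :: T) 0 \/ ~ cone (- l :: T) 0.
Proof.
move=> l0 nT; apply: NNPP => /not_or_and[/NNPP c1 /NNPP c2].
case: (cone_consP c1) => n [t [/esym/eqP e1 h1]].
case: (cone_consP c2) => m [t' [/esym/eqP e2 h2]].
case: h1 => [[n0 t0]|ct].
  by move: e1; rewrite t0 addr0 => /eqP; apply: mulrn_neq0.
case: h2 => [[m0 t0]|ct'].
  by move: e2; rewrite t0 addr0 mulNrn oppr_eq0 => /eqP; apply: mulrn_neq0.
move: e1 e2; rewrite addrC addr_eq0 => /eqP e1.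
rewrite addrC mulNrn subr_eq0 => /eqP e2.
have n0 : (0 < n)%N.
  by rewrite lt0n; apply/eqP => n0; move: ct; rewrite e1 n0 mulr0n oppr0.
have m0 : (0 < m)%N.
  by rewrite lt0n; apply/eqP => m0; move: ct'; rewrite e2 m0 mulr0n.
apply: nT; have -> : 0 = t *+ m + t' *+ n.
  by rewrite e1 e2 mulNrn -!mulrnA mulnC addNr.
by apply: coneD; apply: coneMn.
Qed.

(** A substitute for an ordering of the field: a sign is chosen for one element after the other. *)
Lemma exists_pointed_cone (ls : seq F) : 0 \notin ls ->
  exists2 T, ~ cone T 0 & forall l, l \in ls -> l \in T \/ - l \in T.
Proof.
elim: ls => [_|l ls IH].
  exists [::] => // h.
  have : forall s, cone [::] s -> False by move=> s; elim.
  by move/(_ 0 h).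
rewrite inE negb_or eq_sym => /andP[l0 /IH[T nT hT]].
case: (cone_cons_sign l0 nT) => nc; [exists (l :: T)|exists (- l :: T)] => //.
  move=> x; rewrite inE => /orP[/eqP->|/hT[xT|xT]].
  - by left; rewrite mem_head.
  - by left; rewrite inE xT orbT.
  - by right; rewrite inE xT orbT.
move=> x; rewrite inE => /orP[/eqP->|/hT[xT|xT]].
- by right; rewrite mem_head.
- by left; rewrite inE xT orbT.
- by right; rewrite inE xT orbT.
Qed.

End Cones.

(** * Generalized eigenvectors *)

Section Weights.
Variables (F : fieldType) (V : vectType F) (P : 'End(V)).
Implicit Types (l m : F) (x y v w : V).

Definition shift l v : V := P v - l *: v.

Definition weight l v : Prop := exists n, iter n (shift l) v = 0.

Lemma shift0 l : shift l 0 = 0.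
Proof. by rewrite /shift linear0 scaler0 subr0. Qed.

Lemma shiftD l v w : shift l (v + w) = shift l v + shift l w.
Proof. by rewrite /shift linearD scalerDr opprD addrACA. Qed.

Lemma shiftZ l a v : shift l (a *: v) = a *: shift l v.
Proof. by rewrite /shift linearZ scalerBr !scalerA mulrC. Qed.

Lemma iter_shift0 n l : iter n (shift l) 0 = 0.
Proof. by elim: n => //= n ->; apply: shift0. Qed.

Lemma iter_shiftD n l v w :
  iter n (shift l) (v + w) = iter n (shift l) v + iter n (shift l) w.
Proof. by elim: n => //= n ->; apply: shiftD. Qed.

Lemma iter_shiftZ n l a v : iter n (shift l) (a *: v) = a *: iter n (shift l) v.
Proof. by elim: n => //= n ->; apply: shiftZ. Qed.

Lemma iter_shift_leq n p l v : (n <= p)%N ->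
  iter n (shift l) v = 0 -> iter p (shift l) v = 0.
Proof. by move=> /subnK <- e; rewrite iterD e iter_shift0. Qed.

Lemma weight0 l : weight l 0.
Proof. by exists 0%N. Qed.

Lemma weightD l v w : weight l v -> weight l w -> weight l (v + w).
Proof.
move=> [n hn] [m hm]; exists (maxn n m); rewrite iter_shiftD.
by rewrite (iter_shift_leq _ hn) ?leq_maxl // (iter_shift_leq _ hm) ?leq_maxr // addr0.
Qed.

Lemma weightZ l a v : weight l v -> weight l (a *: v).
Proof. by move=> [n hn]; exists n; rewrite iter_shiftZ hn scaler0. Qed.

Lemma weight_shift l v : weight l (shift l v) -> weight l v.
Proof. by move=> [n hn]; exists n.+1; rewrite iterSr. Qed.

(** On weight [m], [shift l] is the nonzero scalar [m - l] plus the locally nilpotent [shift m],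
    hence invertible. *)
Lemma shift_surj_weight l m w : m != l -> weight m w ->
  exists2 v, weight m v & shift l v = w.
Proof.
move=> ml [n]; elim: n w => [w /= ->|n IH w].
  by exists 0; [apply: weight0 | apply: shift0].
rewrite iterSr => hn; case: (IH _ hn) => u wu eu.
have ml0 : m - l != 0 by rewrite subr_eq0.
exists ((m - l)^-1 *: (w - u)).
  apply: weightZ; apply: weightD; last by rewrite -scaleN1r; apply: weightZ.
  by exists n.+1; rewrite iterSr.
rewrite shiftZ shiftD -scaleN1r shiftZ eu scaleN1r /shift opprB.
by rewrite [X in _ *: X]addrC addrA subrK -scalerBl scalerA mulVf // scale1r.
Qed.

(** Primary decomposition as an induction principle: a vector annihilated by the product of the
    shifts is a sum of weight vectors. *)
Lemma weight_ind (rs : seq F) (Q : V -> Prop) v :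
    Q 0 -> (forall x y, Q x -> Q y -> Q (x + y)) ->
    (forall r x, r \in rs -> weight r x -> Q x) ->
  foldl (fun w r => shift r w) v rs = 0 -> Q v.
Proof.
elim: rs Q v => [Q v Q0 _ _ /= -> //|r rs IH Q v Q0 QD Qw /= hv].
have [u [x [Qu wx e]]] :
    exists u x, [/\ Q u, weight r x & shift r v = shift r u + x].
  (* Once [shift r v] is written in this form, [v - u] has weight [r]. Weights other than [r] are
     pulled back through [shift r]. *)
  apply: (IH (fun w => exists u x, [/\ Q u, weight r x & w = shift r u + x])
    (shift r v) _ _ _ hv) => [||s w srs ws].
  - by exists 0, 0; rewrite shift0 addr0; split=> //; apply: weight0.
  - move=> y z [u [x [Qu wx ->]]] [u' [x' [Qu' wx' ->]]].
    exists (u + u'), (x + x'); rewrite shiftD addrACA.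
    by split=> //; [apply: QD | apply: weightD].
  - case: (eqVneq s r) => [<-|sr].
      by exists 0, w; rewrite shift0 add0r.
    have [u wu eu] := shift_surj_weight sr ws.
    exists u, 0; rewrite eu addr0; split=> //; last exact: weight0.
    by apply: (Qw s) => //; rewrite inE srs orbT.
rewrite -(subrK u v); apply: QD => //; apply: (Qw r); first exact: mem_head.
apply: weight_shift; rewrite -scaleN1r shiftD shiftZ scaleN1r e.
by rewrite addrAC subrr add0r.
Qed.

(** Iterating [shift l] reaches a true eigenvector, on which each [shift r] is the scalar [l - r];
    some such scalar must vanish. *)
Lemma weight_root (rs : seq F) l x :
    (forall v, foldl (fun w r => shift r w) v rs = 0) ->
  weight l x -> x <> 0 -> l \in rs.
Proof.
move=> ann [n]; elim: n x => [//|n IH] x; rewrite iterSr => hn x0.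
case: (eqVneq (shift l x) 0) => [e|/eqP]; last exact: IH.
apply/negP => /negP lrs; apply: x0; move: (ann x) lrs e.
elim: (rs) x {hn} => [//|r s IHs] x /= hx; rewrite inE negb_or => /andP[lr ls] e.
have er : shift r x = (l - r) *: x.
  by move/eqP: e; rewrite subr_eq0 /shift => /eqP->; rewrite scalerBl.
have /eqP : shift r x = 0 by apply: IHs => //; rewrite er shiftZ e scaler0.
by rewrite er scaler_eq0 subr_eq0 (negPf lr) => /eqP.
Qed.

End Weights.

(** * Weights of nested brackets *)

Section NestedBrackets.
Variables (F : fieldType) (V : vectType F) (br : V -> V -> V).
Hypothesis hLie : is_lie_bracket br.
Implicit Types (s : seq V) (x y : V).

Lemma rnest_cons x s : s != [::] -> rnest br (x :: s) = br x (rnest br s).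
Proof. by case: s. Qed.

Lemma rnest_rcons s x : rnest br (rcons s x) = foldr br x s.
Proof.
elim: s => [//|y s IH]; rewrite rcons_cons rnest_cons ?IH //.
by case: (s).
Qed.

Lemma rnest_set_nth_linear s i a x y : (i < size s)%N ->
  rnest br (set_nth 0 s i (a *: x + y)) =
  a *: rnest br (set_nth 0 s i x) + rnest br (set_nth 0 s i y).
Proof.
have ne t j z : set_nth 0 t j z != [::] :> seq V.
  by rewrite -size_eq0 size_set_nth -lt0n leq_max.
case: hLie => linl linr _ _.
elim: s i => // z s IH [|i] hi.
  by case: s {IH hi} => // w s; apply: linl.
have e v : rnest br (set_nth 0 (z :: s) i.+1 v) = br z (rnest br (set_nth 0 s i v)).
  exact: rnest_cons.
by rewrite !e IH // linr.
Qed.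

Lemma rnest_nth0 s i : (i < size s)%N -> nth 0 s i = 0 -> rnest br s = 0.
Proof.
elim: s i => // z s IH [|i] hi /= e.
  by rewrite e; case: (s) => // w t; apply: br0l.
by case: s hi e IH => // w s hi e IH; rewrite (IH i) // br0r.
Qed.

Lemma set_nth_nth s i : (i < size s)%N -> set_nth 0 s i (nth 0 s i) = s.
Proof.
move=> hi; apply: (@eq_from_nth _ 0); rewrite size_set_nth (maxn_idPr hi) // => j _.
by rewrite nth_set_nth /=; case: eqP => // ->.
Qed.

Variables (P : 'End(V)) (k : nat).
Hypothesis leib : leibniz_der br k P.

(** The multiple of the bracket that is subtracted is distributed over the terms of the Leibniz
    rule, one weight per slot. *)
Lemma shift_rnest s (ls : seq F) : size s = k.+1 ->
  shift P (\sum_(i < k.+1) nth 0 ls i) (rnest br s) =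
  \sum_(i < k.+1) rnest br (set_nth 0 s i (shift P (nth 0 ls i) (nth 0 s i))).
Proof.
move=> hs; rewrite /shift leib // scaler_suml -sumrB; apply: eq_bigr => i _.
rewrite addrC -!scaleNr [in RHS]addrC rnest_set_nth_linear ?hs //.
by rewrite set_nth_nth ?hs.
Qed.

(** Each shift lowers one entry of [ns], the list of nilpotency orders of the slots; a slot of order
    0 holds the zero vector. *)
Lemma iter_shift_rnest N s (ls : seq F) (ns : seq nat) :
    size s = k.+1 -> size ns = k.+1 -> (sumn ns <= N)%N ->
    (forall i, (i < k.+1)%N ->
      iter (nth 0%N ns i) (shift P (nth 0 ls i)) (nth 0 s i) = 0) ->
  iter N (shift P (\sum_(i < k.+1) nth 0 ls i)) (rnest br s) = 0.
Proof.
elim: N s ns => [|N IH] s ns hs hns hN h0.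
  apply: (@rnest_nth0 _ 0%N); first by rewrite hs.
  by have := h0 0%N isT; case: ns hns hN {h0} => //= -[].
rewrite iterSr shift_rnest //.
rewrite (big_morph _ (iter_shiftD P N _) (iter_shift0 P N _)).
apply: big1 => i _; case E: (nth 0%N ns i) => [|n].
  rewrite (@rnest_nth0 _ i) ?iter_shift0 ?size_set_nth ?leq_maxl //.
  have := h0 i (ltn_ord i); rewrite E /= => ->.
  by rewrite nth_set_nth /= eqxx shift0.
have szi : (i < k.+1)%N by [].
apply: (IH _ (set_nth 0%N ns i n)).
- by rewrite size_set_nth hs (maxn_idPr szi).
- by rewrite size_set_nth hns (maxn_idPr szi).
- rewrite sumn_set_nth_ltn ?hns // E.
  by rewrite leq_subLR addnC addSnnS leq_add2l.
- move=> j hj; rewrite !nth_set_nth /=; case: eqP => [->|_]; last exact: h0.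
  by rewrite -iterSr -E h0.
Qed.

Lemma weight_rnest s (ls : seq F) : size s = k.+1 ->
    (forall i, (i < k.+1)%N -> weight P (nth 0 ls i) (nth 0 s i)) ->
  weight P (\sum_(i < k.+1) nth 0 ls i) (rnest br s).
Proof.
move=> hs hw.
have /fin_all_exists[f hf] (i : 'I_k.+1) := hw i (ltn_ord i).
pose ns := mkseq (fun i => f (inord i)) k.+1.
exists (sumn ns); apply: (@iter_shift_rnest _ _ _ ns); rewrite ?size_mkseq // => i hi.
by rewrite nth_mkseq //; have := hf (inord i); rewrite inordK.
Qed.

End NestedBrackets.

(** * Nilpotency when the weights lie in the base field *)

Section SplitCase.
Variables (F : fieldType) (V : vectType F) (br : V -> V -> V).
Hypothesis hLie : is_lie_bracket br.
Variables (P : 'End(V)) (k : nat) (rs : seq F).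
Hypotheses (leib : leibniz_der br k P) (k_gt0 : (0 < k)%N).
Hypothesis annP : forall v, foldl (fun w r => shift P r w) v rs = 0.
Implicit Types (S : V -> Prop) (C : F -> Prop) (x v : V) (l m : F).

(** Used with [i = k], since the Leibniz rule controls products of exactly [k] bracket maps. *)
Lemma kills_foldr S i j v :
    (forall xs, size xs = i -> (forall x, x \in xs -> S x) ->
      kills br S j (foldr br v xs)) ->
  kills br S (i + j) v.
Proof.
elim: i v => [v /(_ [::]) h|i IH v h]; first by apply: h.
move=> u Su; apply: IH => xs hxs hS.
rewrite -foldr_rcons; apply: h; first by rewrite size_rcons hxs.
by move=> x; rewrite mem_rcons inE => /orP[/eqP->|/hS].
Qed.

Definition weights_in C x : Prop := exists2 l, C l & weight P l x.

Section PointedCone.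
Variable C : F -> Prop.
Hypotheses (CD : forall l m, C l -> C m -> C (l + m)) (C0 : ~ C 0).

(** The product is a nested bracket of [k.+1] vectors, so weights add up; [c] lies in [C] because
    [k > 0] makes the sum nonempty. *)
Lemma weight_foldr xs v m : size xs = k ->
    (forall x, x \in xs -> weights_in C x) -> weight P m v ->
  exists2 c, C c & weight P (c + m) (foldr br v xs).
Proof.
move=> hk hxs wv.
have [ls [hls [hC hw]]] : exists ls : seq F, size ls = size xs /\
    ((forall l, l \in ls -> C l) /\
     forall i, (i < size xs)%N -> weight P (nth 0 ls i) (nth 0 xs i)).
  elim: xs hxs {hk} => [_|x xs IH hxs]; first by exists [::].
  have [|ls [hls [hC hw]]] := IH; first by move=> y yxs; apply: hxs; rewrite inE yxs orbT.
  have [l Cl wl] := hxs x (mem_head _ _).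
  exists (l :: ls); split; first by rewrite /= hls.
  split=> [y|[|i]] //=; last exact: hw.
  by rewrite inE => /orP[/eqP->|/hC].
exists (\sum_(l <- ls) l).
  have : ls != [::] by rewrite -size_eq0 hls hk -lt0n.
  elim: ls hC {hls hw} => // l ls IH hC _; rewrite big_cons.
  case: (eqVneq ls [::]) => [->|nls].
    by rewrite big_nil addr0; apply: hC; rewrite mem_head.
  apply: CD; first by apply: hC; rewrite mem_head.
  by apply: IH => // l' hl'; apply: hC; rewrite inE hl' orbT.
rewrite -rnest_rcons.
have -> : \sum_(l <- ls) l + m = \sum_(i < k.+1) nth 0 (rcons ls m) i.
  transitivity (\sum_(l <- rcons ls m) l); first by rewrite big_rcons.
  by rewrite (big_nth 0) size_rcons hls hk big_mkord.
apply: (weight_rnest hLie leib); first by rewrite size_rcons hk.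
move=> i; rewrite ltnS leq_eqVlt => /orP[/eqP->|ik].
  by rewrite !nth_rcons hls hk ltnn eqxx.
by rewrite !nth_rcons hls hk ik; apply: hw; rewrite hk.
Qed.

(* Along an orbit the weights are pairwise distinct elements of [rs]; [vis]
   lists those already visited. *)
Lemma kills_weight n v m (vis : seq F) :
    weight P m v -> uniq vis -> {subset vis <= rs} ->
    (forall l, l \in vis -> C (m - l)) -> (size rs <= size vis + n)%N ->
  kills br (weights_in C) (n * k) v.
Proof.
elim: n v m vis => [|n IH] v m vis wv uv sv cv hn.
  rewrite mul0n /=; apply: NNPP => v0.
  have mrs := weight_root annP wv v0.
  have mvis : m \notin vis by apply/negP => /cv; rewrite subrr.
  (* With no steps left [vis] is as long as [rs], so there is no room for the new weight [m]. *)
  have : (size (m :: vis) <= size rs)%N.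
    apply: uniq_leq_size; first by rewrite /= mvis.
    by move=> x; rewrite inE => /orP[/eqP->|/sv].
  by rewrite /= ltnNge; move: hn; rewrite addn0 => ->.
case: (classic (v = 0)) => [->|v0]; first exact: kills0.
have mrs := weight_root annP wv v0.
have mvis : m \notin vis by apply/negP => /cv; rewrite subrr.
rewrite mulSn; apply: kills_foldr => xs hxs hS.
have [c Cc wc] := weight_foldr hxs hS wv.
apply: (IH _ (c + m) (m :: vis)) => //.
- by rewrite /= mvis.
- by move=> x; rewrite inE => /orP[/eqP->|/sv].
- move=> l; rewrite inE => /orP[/eqP->|/cv cl]; first by rewrite addrK.
  by rewrite -addrA; apply: CD.
- by rewrite /= addSnnS.
Qed.

Lemma weights_in_nilpotent : acts_nilpotently br (weights_in C).
Proof.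
exists (size rs * k)%N => v.
apply: (@weight_ind _ _ P rs (kills br (weights_in C) (size rs * k))) (annP v).
- exact: kills0.
- by move=> x y; apply: killsD.
- by move=> r x _ wx; apply: (@kills_weight _ _ r [::]).
Qed.

End PointedCone.

Theorem split_leibniz_nilpotent : [pchar F] =i pred0 -> injective P ->
  acts_nilpotently br (fun _ => True).
Proof.
move=> charF0 injP; pose ls := [seq r <- rs | r != 0].
have [|T T0 hT] := @exists_pointed_cone _ charF0 ls; first by rewrite mem_filter eqxx.
pose C2 l := cone T (- l).
have n1 : acts_nilpotently br (weights_in (cone T)).
  by apply: weights_in_nilpotent => //; apply: coneD.
have n2 : acts_nilpotently br (weights_in C2).
  apply: weights_in_nilpotent; last by rewrite /C2 oppr0.
  by move=> l m; rewrite /C2 opprD; apply: coneD.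
apply: (nilpotent_sum hLie n1 n2) => v.
pose Q w := exists a b, [/\ nil_envelope br (weights_in (cone T)) a,
  nil_envelope br (weights_in C2) b & w = a + b].
apply: (@weight_ind _ _ P rs Q) (annP v).
- by exists 0, 0; rewrite addr0; split=> //; apply: nil_envelope0.
- move=> _ _ [a [b [na nb ->]]] [a' [b' [na' nb' ->]]].
  exists (a + a'), (b + b'); rewrite addrACA.
  by split=> //; apply: nil_envelopeD.
- move=> r x rrs wx; case: (eqVneq r 0) => [r0|r0].
    (* The list [rs] may contain 0, but an injective [P] has no nonzero vector of weight 0. *)
    have -> : x = 0.
      case: wx => n; rewrite r0; elim: n => //= n IH e.
      by apply/IH/injP; rewrite linear0 -e /shift scale0r subr0.
    by exists 0, 0; rewrite addr0; split=> //; apply: nil_envelope0.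
  have /hT[rT|rT] : r \in ls by rewrite mem_filter r0.
    exists x, 0; rewrite addr0; split=> //; last exact: nil_envelope0.
    by apply: sub_nil_envelope; exists r => //; apply: cone_gen.
  exists 0, x; rewrite add0r; split=> //; first exact: nil_envelope0.
  by apply: sub_nil_envelope; exists r => //; apply: cone_gen.
Qed.

End SplitCase.

(** * Splitting fields and Cayley-Hamilton *)

Lemma exists_irreducible_factor (F : fieldType) (p : {poly F}) :
  (1 < size p)%N -> exists2 q, irreducible_poly q & q %| p.
Proof.
have [n] := ubnP (size p); elim: n p => // n IH p hn p1.
case: (classic (irreducible_poly p)) => [|nirr]; first by exists p.
have [q [q1 [qp nqp]]] : exists q : {poly F}, size q != 1%N /\ (q %| p /\ ~ q %= p).
  apply: NNPP => nex; apply: nirr; split=> // q q1 qp.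
  by apply/negP => /negP nqp; apply: nex; exists q; split=> //; split=> //; apply/negP.
have p0 : p != 0 by rewrite -size_poly_gt0 ltnW.
have q0 : q != 0 by apply: contraNneq p0 => q0; rewrite q0 dvd0p in qp.
have sq1 : (1 < size q)%N by rewrite ltn_neqAle eq_sym q1 size_poly_gt0.
have sqp : (size q < size p)%N.
  by rewrite ltn_neqAle dvdp_leq // andbT; apply/negP; rewrite dvdp_size_eqp.
have [r irr rq] := IH q (leq_trans sqp hn) sq1.
by exists r => //; apply: dvdp_trans qp.
Qed.

(** A root of an irreducible factor is adjoined and split off; the induction on size lets the base
    field vary. *)
Lemma exists_splitting_extension (F : fieldType) (p : {poly F}) : p \is monic ->
  exists (L : fieldType) (f : {rmorphism F -> L}) (rs : seq L),
    map_poly f p = \prod_(r <- rs) ('X - r%:P).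
Proof.
have [n] := ubnP (size p); elim: n F p => // n IH F p hn mp.
case: (leqP (size p) 1) => p1.
  exists F, idfun, [::]; rewrite big_nil map_poly_id //.
  have e := size1_polyC p1; move/monicP: mp.
  by rewrite e lead_coefC => ->.
have [q irr qp] := exists_irreducible_factor p1.
have [K _ [z rz _]] := irredp_FAdjoin irr.
have rp : root (map_poly (in_alg K) p) z.
  by move: rz; rewrite -!dvdp_XsubCl => /dvdp_trans; apply; rewrite dvdp_map.
have [p' ep] := factor_theorem _ _ rp.
have mp' : p' \is monic.
  have : map_poly (in_alg K) p \is monic by rewrite map_monic.
  by rewrite ep monicMr ?monicXsubC.
have sp' : (size p' < n)%N.
  have := size_map_poly (in_alg K) p; rewrite ep size_Mmonic ?monicXsubC //.
    by rewrite size_XsubC addn2 /= => e; rewrite e.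
  exact: monic_neq0.
have [L [g [rs hrs]]] := IH K p' sp' mp'.
pose h : {rmorphism F -> L} := (g \o in_alg K)%FUN.
exists L, h, (g z :: rs).
rewrite big_cons -hrs [map_poly h p](map_poly_comp g (in_alg K)) ep rmorphM /= mulrC.
by rewrite rmorphB /= map_polyX map_polyC.
Qed.

(** Cayley-Hamilton in the iterated form that [weight_ind] and [weight_root] expect. *)
Lemma char_poly_annihilates (F : fieldType) n (M : 'M[F]_n) (rs : seq F) (v : 'rV_n) :
    char_poly M = \prod_(r <- rs) ('X - r%:P) ->
  foldl (fun w r => w *m M - r *: w) v rs = 0.
Proof.
case: n M v => [|n] M v hM; first by rewrite [LHS]thinmx0.
have := Cayley_Hamilton M; rewrite hM => /(congr1 (mulmx v)); rewrite mulmx0 => <-.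
elim: rs v {hM} => [|r rs IH] v; first by rewrite big_nil rmorph1 mulmx1.
rewrite big_cons rmorphM /= mulmxA -IH rmorphB /= horner_mx_X horner_mx_C.
by rewrite mulmxBr mul_mx_scalar.
Qed.

(** * Multilinearity of the Leibniz rule *)

Section LeibnizSum.
Variables (F : fieldType) (V : vectType F) (br : V -> V -> V).
Hypothesis hLie : is_lie_bracket br.
Variable P : 'End(V).
Implicit Types (s : seq V) (x y : V).

(** Defined for lists of every length, so that it can be unfolded recursively although the order [k]
    is fixed. *)
Definition leibniz_sum s : V :=
  \sum_(i < size s) rnest br (set_nth 0 s i (P (nth 0 s i))).

Lemma leibniz_derE k : leibniz_der br k P <->
  forall s, size s = k.+1 -> P (rnest br s) = leibniz_sum s.
Proof. by split=> h s hs; rewrite h // /leibniz_sum hs. Qed.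

Lemma leibniz_sum1 x : leibniz_sum [:: x] = P x.
Proof. by rewrite /leibniz_sum big_ord1. Qed.

Lemma leibniz_sum_cons x s : s != [::] ->
  leibniz_sum (x :: s) = br (P x) (rnest br s) + br x (leibniz_sum s).
Proof.
move=> s0; rewrite /leibniz_sum big_ord_recl -rnest_cons //; congr (_ + _).
rewrite (big_morph _ (brDr hLie x) (br0r hLie x)); apply: eq_bigr => i _.
by rewrite -rnest_cons // -size_eq0 size_set_nth -lt0n leq_max.
Qed.

Lemma cat_cons_neq0 (s1 s2 : seq V) x : s1 ++ x :: s2 != [::].
Proof. by case: s1. Qed.

Lemma rnest_slot_linear s1 s2 a x y :
  rnest br (s1 ++ (a *: x + y) :: s2) =
  a *: rnest br (s1 ++ x :: s2) + rnest br (s1 ++ y :: s2).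
Proof.
elim: s1 => [|z s1 IH].
  by case: s2 => // w s2; rewrite /= (brDl hLie) (brZl hLie).
by rewrite !cat_cons !rnest_cons ?cat_cons_neq0 // IH (brDr hLie) (brZr hLie).
Qed.

Lemma leibniz_sum_slot_linear s1 s2 a x y :
  leibniz_sum (s1 ++ (a *: x + y) :: s2) =
  a *: leibniz_sum (s1 ++ x :: s2) + leibniz_sum (s1 ++ y :: s2).
Proof.
elim: s1 => [|z s1 IH].
  case: s2 => [|w s2]; first by rewrite !cat0s !leibniz_sum1 linearP.
  have : w :: s2 != [::] by []; move: (w :: s2) => t t0.
  rewrite !cat0s !leibniz_sum_cons // linearP.
  by rewrite !(brDl hLie) !(brZl hLie) scalerDr addrACA.
rewrite !cat_cons !leibniz_sum_cons ?cat_cons_neq0 // IH rnest_slot_linear.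
by rewrite !(brDr hLie) !(brZr hLie) scalerDr addrACA.
Qed.

End LeibnizSum.

(** * Extension of scalars *)

Section BaseChange.
Variables (F : fieldType) (V : vectType F) (br : V -> V -> V).
Hypothesis hLie : is_lie_bracket br.
Variables (P : 'End(V)) (L : fieldType) (f : {rmorphism F -> L}).
Local Notation n := (dim V).
Local Notation W := 'rV[L]_n.

(** The tensor product of [L] with [V] is modelled by coordinate rows over [L]; this is the map from
    [v] to [1] tensor [v]. *)
Definition extv (v : V) : W := map_mx f (v2r v).

Lemma extvD u v : extv (u + v) = extv u + extv v.
Proof. by rewrite /extv linearD map_mxD. Qed.

Lemma extvZ a v : extv (a *: v) = f a *: extv v.
Proof. by rewrite /extv linearZ map_mxZ. Qed.

Lemma extv0 : extv 0 = 0.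
Proof. by rewrite /extv linear0 map_mx0. Qed.

Lemma extv_inj : injective extv.
Proof. by move=> u v /map_mx_inj /v2r_inj. Qed.

Definition std_vec (i : 'I_n) : V := r2v (delta_mx 0 i).

Lemma std_vec_sum v : v = \sum_i v2r v 0 i *: std_vec i.
Proof.
apply: v2r_inj; rewrite linear_sum [LHS]row_sum_delta.
by apply: eq_bigr => i _; rewrite linearZ /= r2vK.
Qed.

(** The image of [V] spans over [L], so linear identities need checking only on it. *)
Lemma extv_ind (Q : W -> Prop) :
    (forall a x y, Q x -> Q y -> Q (a *: x + y)) -> (forall v, Q (extv v)) ->
  forall w, Q w.
Proof.
move=> QD Qv w; rewrite (row_sum_delta w).
have Q0 : Q 0 by rewrite -extv0.
elim: (index_enum _) => [|i I IH]; first by rewrite big_nil.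
rewrite big_cons; apply: QD => //.
by have := Qv (std_vec i); rewrite /extv r2vK map_delta_mx.
Qed.

Definition ext_br (x y : W) : W :=
  \sum_i \sum_j (x 0 i * y 0 j) *: extv (br (std_vec i) (std_vec j)).

Lemma ext_br_linl a x y z : ext_br (a *: x + y) z = a *: ext_br x z + ext_br y z.
Proof.
rewrite scaler_sumr -big_split; apply: eq_bigr => i _ /=.
rewrite scaler_sumr -big_split; apply: eq_bigr => j _ /=.
by rewrite !mxE scalerA -scalerDl mulrDl mulrA.
Qed.

Lemma ext_br_linr a x y z : ext_br x (a *: y + z) = a *: ext_br x y + ext_br x z.
Proof.
rewrite scaler_sumr -big_split; apply: eq_bigr => i _ /=.
rewrite scaler_sumr -big_split; apply: eq_bigr => j _ /=.
by rewrite !mxE scalerA -scalerDl mulrDr mulrCA.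
Qed.

Lemma ext_brE u v : ext_br (extv u) (extv v) = extv (br u v).
Proof.
rewrite [in RHS](std_vec_sum u) [in RHS](std_vec_sum v).
rewrite (big_morph (br^~ _) (fun x y => brDl hLie x y _) (br0l hLie _)).
rewrite (big_morph _ extvD extv0); apply: eq_bigr => i _.
rewrite (big_morph _ (brDr hLie _) (br0r hLie _)) (big_morph _ extvD extv0).
apply: eq_bigr => j _.
by rewrite (brZl hLie) (brZr hLie) scalerA extvZ rmorphM !mxE.
Qed.

Lemma ext_br_lie : is_lie_bracket ext_br.
Proof.
(* Antisymmetry comes first because [br x x = 0] is quadratic: its linearization leaves cross terms
   to cancel. *)
have anti x y : ext_br x y = - ext_br y x.
  move: x; apply: extv_ind => [a x x' e e'|u].
    by rewrite ext_br_linl ext_br_linr e e' opprD scalerN.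
  move: y; apply: extv_ind => [a y y' e e'|v].
    by rewrite ext_br_linl ext_br_linr e e' opprD scalerN.
  by rewrite !ext_brE (br_anti hLie) -!scaleN1r extvZ rmorphN1.
split; [exact: ext_br_linl|exact: ext_br_linr| |].
  apply: extv_ind => [a x y ex ey|v]; last by rewrite ext_brE br_xx ?extv0.
  rewrite ext_br_linl !ext_br_linr ex ey scaler0 add0r addr0 (anti y x).
  by rewrite scalerN subrr.
have comb (a : L) (A B C A' B' C' : W) : A + B + C = 0 -> A' + B' + C' = 0 ->
    (a *: A + A') + (a *: B + B') + (a *: C + C') = 0.
  move=> e e'; rewrite (addrACA (a *: A)) (addrACA (a *: A + _)) e'.
  by rewrite -!scalerDr e scaler0 addr0.
have lin := (ext_br_linl, ext_br_linr).
move=> x y z; move: x; apply: extv_ind => [a x x' e e'|u].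
  by rewrite !lin; apply: comb.
move: y; apply: extv_ind => [a y y' e e'|v]; first by rewrite !lin; apply: comb.
move: z; apply: extv_ind => [a z z' e e'|w]; first by rewrite !lin; apply: comb.
rewrite !ext_brE -!extvD; case: hLie => _ _ _ ->; exact: extv0.
Qed.

Definition ext_mx : 'M[L]_n := map_mx f (lin1_mx (v2r \o P \o r2v)).

Definition ext_end : 'End(W) := linfun (mulmxr ext_mx).

Lemma ext_endE w : ext_end w = w *m ext_mx.
Proof. by rewrite lfunE. Qed.

Lemma ext_end_extv v : ext_end (extv v) = extv (P v).
Proof. by rewrite ext_endE -map_mxM mul_rV_lin1 /= v2rK. Qed.

(** The matrix of the inverse of [P], mapped along [f], still inverts [ext_mx]. *)
Lemma ext_end_inj : injective P -> injective ext_end.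
Proof.
move/lker0P => kP.
pose N := map_mx f (lin1_mx (v2r \o (P^-1)%VF \o r2v)).
have MN : ext_mx *m N = 1%:M.
  rewrite -map_mxM -(map_mx1 f); congr map_mx; apply/row_matrixP => i.
  by rewrite !rowE mulmx1 mulmxA !mul_rV_lin1 /= v2rK lker0_lfunK // r2vK.
apply: (can_inj (g := mulmx^~ N)) => w.
by rewrite ext_endE -mulmxA MN mulmx1.
Qed.

Lemma rnest_extv s : rnest ext_br (map extv s) = extv (rnest br s).
Proof.
elim: s => [|x s IH]; first by rewrite extv0.
case: s IH => // y s IH.
by rewrite map_cons [LHS]rnest_cons // IH ext_brE.
Qed.

Lemma leibniz_sum_extv s :
  leibniz_sum ext_br ext_end (map extv s) = extv (leibniz_sum br P s).
Proof.
elim: s => [|x s IH]; first by rewrite /leibniz_sum !big_ord0 extv0.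
case: s IH => [_|y s IH]; first by rewrite !leibniz_sum1 ext_end_extv.
rewrite map_cons (leibniz_sum_cons ext_br_lie) // (leibniz_sum_cons hLie) //.
by rewrite IH ext_end_extv extvD rnest_extv !ext_brE.
Qed.

Lemma ext_end_leibniz k : leibniz_der br k P -> leibniz_der ext_br k ext_end.
Proof.
move=> /leibniz_derE leib; apply/leibniz_derE => s.
(* The arbitrary vectors in [s1] are traded one at a time for vectors from [V], by linearity in the
   last slot of [s1]. *)
suff H (s1 : seq W) (s2 : seq V) : (size s1 + size s2 = k.+1)%N ->
    ext_end (rnest ext_br (s1 ++ map extv s2)) =
    leibniz_sum ext_br ext_end (s1 ++ map extv s2).
  by move=> hs; have := H s [::]; rewrite addn0 cats0; apply.
elim/last_ind: s1 s2 => [|s1 x IH] s2 hs.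
  by rewrite !cat0s rnest_extv leibniz_sum_extv ext_end_extv leib.
rewrite size_rcons in hs; rewrite cat_rcons; move: x.
apply: extv_ind => [a x y hx hy|v].
  by rewrite (rnest_slot_linear ext_br_lie) (leibniz_sum_slot_linear ext_br_lie)
    linearP /= hx hy.
by rewrite -map_cons; apply: IH; rewrite -hs addSnnS.
Qed.

Lemma kills_extv j v : kills ext_br (fun _ => True) j (extv v) ->
  kills br (fun _ => True) j v.
Proof.
elim: j v => /= [v|j IH v h u _]; first by rewrite -extv0 => /extv_inj.
by apply: IH; rewrite -ext_brE; apply: h.
Qed.

End BaseChange.

(** * Lower central series *)

Section LowerCentralSeries.
Variables (F : fieldType) (V : vectType F) (br : V -> V -> V).
Hypothesis hLie : is_lie_bracket br.

Lemma mem_bracket_space (A B : {vspace V}) x y :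
  x \in A -> y \in B -> br x y \in bracket_space br A B.
Proof.
move=> xA yB; rewrite (coord_vbasis xA) (coord_vbasis yB).
rewrite (big_morph (br^~ _) (fun u v => brDl hLie u v _) (br0l hLie _)).
apply: memv_suml => i _.
rewrite (big_morph _ (brDr hLie _) (br0r hLie _)); apply: memv_suml => j _.
rewrite (brZl hLie) (brZr hLie); do 2! apply: memvZ; apply: memv_span.
by apply: allpairs_f; apply: mem_nth; rewrite size_tuple.
Qed.

Lemma rnest_in_lcs s x : rnest br (rcons s x) \in lcs br (size s).
Proof.
rewrite rnest_rcons; elim: s => [|y s IH] /=; first exact: memvf.
by apply: mem_bracket_space; rewrite ?memvf.
Qed.

(** An element of [lcs br m] is a combination of brackets that already use up [m] of the [m + n]
    factors. *)
Lemma kills_lcs n m x : (forall v, kills br (fun _ => True) (m + n) v) ->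
  x \in lcs br m -> kills br (fun _ => True) n x.
Proof.
elim: m n x => [|m IH] n x hk //= hx.
have {}IH v : v \in lcs br m -> kills br (fun _ => True) n.+1 v.
  by apply: IH => w; rewrite addnS.
pose X := [seq br u v | u <- vbasis fullv, v <- vbasis (lcs br m)].
rewrite (coord_span (hx : x \in <<in_tuple X>>%VS)).
elim/big_rec: _ => [|i z _ kz]; first exact: kills0.
apply: killsD => //; apply: killsZ => //.
have /allpairsP[[u v] /= [_ vB ->]] : X`_i \in X by exact: mem_nth.
by apply: (IH v) => //; apply: vbasis_mem.
Qed.

Lemma lie_nilpotent_of_kills :
  acts_nilpotently br (fun _ => True) -> lie_nilpotent br.
Proof.
case=> n kn; exists n; apply/eqP; rewrite -subv0; apply/subvP => x hx.
by rewrite memv0; apply/eqP; apply: (@kills_lcs 0 n) => //; rewrite addn0.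
Qed.

(** Both sides of the rule vanish. The order [n.+1] stays positive even for [n = 0]. *)
Lemma nilpotent_id_leibniz n : lcs br n = 0%VS -> leibniz_der br n.+1 \1%VF.
Proof.
move=> hn; have r0 s : size s = n.+2 -> rnest br s = 0.
  case/lastP: s => // s x; rewrite size_rcons => -[hs].
  rewrite rnest_rcons; case: s hs => // y s [hs] /=; rewrite -rnest_rcons.
  have := rnest_in_lcs s x; rewrite hs hn memv0 => /eqP->; exact: br0r.
move=> s hs; rewrite id_lfunE r0 // big1 // => i _.
by apply: r0; rewrite size_set_nth hs; apply/maxn_idPr.
Qed.

End LowerCentralSeries.

(** * Nilpotency and invertible Leibniz-derivations *)

Theorem mainTheorem1 (F : fieldType) (charF0 : [pchar F] =i pred0)
    (V : vectType F) (br : V -> V -> V) (hLie : is_lie_bracket br) :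
  lie_nilpotent br <->
  exists k : nat, (1 <= k)%N /\
    exists P : 'End(V), bijective P /\ leibniz_der br k P.
Proof.
split=> [[n hn]|[k [k_gt0 [P [/bij_inj injP leib]]]]].
  exists n.+1; split=> //; exists \1%VF; split; last exact: nilpotent_id_leibniz.
  by exists id => x; rewrite id_lfunE.
(* Over [L] the roots [rs] of the characteristic polynomial of [P] supply the weights of
   [ext_end P f]. *)
have [L [f [rs hrs]]] :=
  exists_splitting_extension (char_poly_monic (lin1_mx (v2r \o P \o r2v))).
have charL0 : [pchar L] =i pred0 by move=> p; rewrite (fmorph_pchar f).
have ann w : foldl (fun w r => shift (ext_end P f) r w) w rs = 0.
  rewrite -[RHS](@char_poly_annihilates _ _ (ext_mx P f) rs w).
    elim: (rs) w => //= r s IH w; rewrite IH.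
    by rewrite /shift ext_endE.
  by rewrite -hrs map_char_poly.
have [n kn] := split_leibniz_nilpotent (ext_br_lie hLie f)
  (ext_end_leibniz hLie f leib) k_gt0 ann charL0 (ext_end_inj (f := f) injP).
apply: lie_nilpotent_of_kills => //; exists n => v.
exact: kills_extv (kn _).
Qed.
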